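(* Let $\varepsilon>0$. For any oriented graph $\overrightarrow{F}$ with order $h$, there exist $\delta>0$ and $n_0\in\mathbb{N}$ such that any oriented graph $\overrightarrow{G}$ of order $n\geq n_0$ with at least $\left(\pi_o(\overrightarrow{F})+\varepsilon\right)\binom{n}{2}$ arcs contains at least $\delta\binom{n}{h}$ copies of $\overrightarrow{F}$.
   Context: An oriented graph is a (finite) digraph without loops, without parallel arcs and without directed cycles of length two. Its order is its number of vertices and its size is its number of arcs. A copy of $\overrightarrow{F}$ in $\overrightarrow{G}$ is a (not necessarily induced) subdigraph of $\overrightarrow{G}$ isomorphic to $\overrightarrow{F}$; $\overrightarrow{G}$ is $\overrightarrow{F}$-free if it contains no copy of $\overrightarrow{F}$. The oriented Turán number $\mathrm{ex}_o(n,\overrightarrow{F})$ is the largest number of arcs in an $n$-vertex $\overrightarrow{F}$-free oriented graph. The oriented Turán density of $\overrightarrow{F}$ is $\pi_o(\overrightarrow{F})=\lim_{n\to\infty}\mathrm{ex}_o(n,\overrightarrow{F})/\binom{n}{2}$ (this limit exists for every oriented graph $\overrightarrow{F}$). *)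

(* Defs.v *)
From HB Require Import structures.
From mathcomp Require Import all_boot all_order all_algebra.
From mathcomp Require Import all_classical all_reals all_analysis.
Set Implicit Arguments.
Unset Strict Implicit.
Unset Printing Implicit Defensive.
Import Order.TTheory GRing.Theory Num.Theory.
Import numFieldNormedType.Exports.

(* The arc from x to y is the pair (x, y). Parallel arcs are excluded because
   arcs form a set. *)
Definition is_oriented (V : finType) (A : {set V * V}) : bool :=
  [forall x, (x, x) \notin A] &&
  [forall x, forall y, ((x, y) \in A) ==> ((y, x) \notin A)].

Record oriented_graph (V : finType) := OrientedGraph {
  arcs : {set V * V};
  _ : is_oriented arcs
}.

HB.instance Definition _ (V : finType) := [isSub for @arcs V].
HB.instance Definition _ (V : finType) :=
  [Finite of oriented_graph V by <:].

Section Copies.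
Variables U V : finType.

(* A subdigraph is given by its vertex set H.1 and its arc set H.2; both are
   recorded, as isolated vertices are not determined by the arcs. *)
Definition subdigraph (G : oriented_graph V)
    (H : {set V} * {set V * V}) : bool :=
  (H.2 \subset arcs G) && (H.2 \subset finset.setX H.1 H.1).

(* For injective f with image H.1, i.e. a bijection from U onto H.1. *)
Definition isomorphic_to (F : oriented_graph U)
    (H : {set V} * {set V * V}) : bool :=
  [exists f : {ffun U -> V},
    [&& injectiveb f, f @: [set: U] == H.1 &
        [forall u, forall v,
          ((u, v) \in arcs F) == ((f u, f v) \in H.2)]]].

Definition copies (F : oriented_graph U) (G : oriented_graph V) :
    {set {set V} * {set V * V}} :=
  [set H | subdigraph G H && isomorphic_to F H].

Definition copy_free (F : oriented_graph U) (G : oriented_graph V) : bool :=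
  copies F G == finset.set0.

End Copies.

(* The maximum of the empty family is 0; this only occurs when F has no arcs
   and at most n vertices. *)
Definition ex_o (U : finType) (n : nat) (F : oriented_graph U) : nat :=
  \max_(G : oriented_graph 'I_n | copy_free F G) #|arcs G|.

Local Open Scope classical_set_scope.
Local Open Scope ring_scope.

Definition pi_o (R : realType) (U : finType) (F : oriented_graph U) : R :=
  lim ((fun n : nat => (ex_o n F)%:R / ('C(n, 2))%:R : R) @ \oo).

(* Main.v *)
(** Average over the [m]-subsets [M] of the vertex set of [G].  Each arc of [G]
lies in ['C(n - 2, m - 2)] of them, so the mean arc density of the induced
subgraphs [G[M]] is that of [G].  If [G] is [F]-free this shows that
[ex_o(n, F) / 'C(n, 2)] is nonincreasing, hence converges to [pi_o(F)].  In
general, fix [m] with [ex_o(m, F) < (pi_o(F) + eps / 2) 'C(m, 2)]: a positive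
proportion of the [M] have more than [ex_o(m, F)] arcs, hence contain a copy of
[F], while each copy is counted only ['C(n - h, m - h)] times. *)

Require Import Defs.
From mathcomp Require Import all_boot all_order all_algebra.
From mathcomp Require Import all_classical all_reals all_analysis.
From mathcomp Require Import lra.
Set Implicit Arguments.
Unset Strict Implicit.
Unset Printing Implicit Defensive.
Import Order.TTheory GRing.Theory Num.Theory.
Import numFieldNormedType.Exports.
Local Open Scope ring_scope.

(** * Double counting of nested sets *)

Lemma mul_bin_bin (n m k : nat) : (k <= m)%N -> (m <= n)%N ->
  ('C(n, m) * 'C(m, k) = 'C(n, k) * 'C(n - k, m - k))%N.
Proof.
move=> km mn; have kn := leq_trans km mn.
have pos : (0 < k`! * ((m - k)`! * (n - m)`!))%N by rewrite !muln_gt0 !fact_gt0.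
apply/eqP; rewrite -(eqn_pmul2r pos); apply/eqP.
transitivity n`!.
  by rewrite -(bin_fact mn) -(bin_fact km) -!mulnA.
rewrite -(bin_fact kn) -(bin_fact (leq_sub2r k mn)) subnBA // subnK //.
by rewrite -!mulnA; congr (_ * _)%N; rewrite mulnCA.
Qed.

(** Removing [A] is a bijection from these [M] onto the subsets of the complement of [A] with
    [m - #|A|] elements. *)
Lemma card_supersets (V : finType) (A : {set V}) (m : nat) : (#|A| <= m)%N ->
  #|[set M : {set V} | (#|M| == m) && (A \subset M)]| =
  'C(#|V| - #|A|, m - #|A|).
Proof.
move=> Am; have <- : #|~: A| = (#|V| - #|A|)%N.
  by rewrite cardsCs finset.setCK.
rewrite -cards_draws -(card_in_imset (f := fun M => M :\: A)).
  apply: eq_card => B; rewrite [RHS]inE; apply/imsetP/andP.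
    case=> M; rewrite inE => /andP[/eqP cM AM] ->; split.
      by rewrite finset.setDE finset.subsetIr.
    by rewrite cardsD (finset.setIidPr AM) cM.
  case=> BA /eqP cB; have dAB : [disjoint A & B].
    by rewrite disjoint_sym finset.disjoints_subset.
  exists (A :|: B).
    rewrite inE finset.subsetUl andbT cardsU (disjoint_setI0 dAB) cards0 subn0.
    by rewrite cB subnKC.
  rewrite finset.setDUl finset.setDv finset.set0U.
  by apply/esym/finset.setDidPl; rewrite disjoint_sym.
move=> M N; rewrite !inE => /andP[_ AM] /andP[_ AN] eMN.
by rewrite -(finset.setID M A) -(finset.setID N A) eMN (finset.setIidPr AM)
  (finset.setIidPr AN).
Qed.

(** Counts the pairs [(i, M)] with [S i] inside [M] in two ways. It serves for arcs with their pairs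
    of ends and for copies with their vertex sets. *)
Lemma sum_card_subset (I V : finType) (S : I -> {set V}) (A : {set I})
    (k m : nat) : (k <= m)%N -> {in A, forall i, #|S i| = k} ->
  (\sum_(M : {set V} | #|M| == m) #|[set i in A | S i \subset M]| =
   #|A| * 'C(#|V| - k, m - k))%N.
Proof.
move=> km Sk.
under eq_bigr => M _ do rewrite -sum1dep_card.
rewrite (exchange_big_dep (mem A)) /=; last by move=> M i _ /andP[].
rewrite -sum_nat_const; apply: eq_bigr => i iA.
rewrite sum1dep_card -(Sk i iA) -card_supersets ?Sk //.
by apply: eq_card => M; rewrite !inE iA.
Qed.

(** * Copies as images of injective homomorphisms *)

Section Homomorphisms.
Variables U V : finType.

Definition homomorphism (F : oriented_graph U) (G : oriented_graph V)
    (f : U -> V) : Prop :=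
  forall u v, (u, v) \in arcs F -> (f u, f v) \in arcs G.

Definition image_subdigraph (F : oriented_graph U) (f : U -> V) :
    {set V} * {set V * V} :=
  (f @: [set: U], [set (f a.1, f a.2) | a in arcs F]).

(** Together with [copies_hom], this lets a copy be moved from one host graph to another by
    composing maps. *)
Lemma image_copies (F : oriented_graph U) (G : oriented_graph V) (f : U -> V) :
  injective f -> homomorphism F G f -> image_subdigraph F f \in copies F G.
Proof.
move=> f_inj f_hom; rewrite inE; apply/andP; split.
  apply/andP; split; apply/fintype.subsetP => _ /imsetP[[u v] uvF ->] /=.
    exact: f_hom.
  by rewrite finset.in_setX !imset_f.
apply/existsP; exists [ffun u => f u]; apply/and3P; split.
- by apply/injectiveP => u v; rewrite !ffunE; apply: f_inj.
- by apply/eqP; apply: eq_imset => u; rewrite ffunE.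
apply/forallP => u; apply/forallP => v; rewrite !ffunE /=; apply/eqP.
apply/idP/imsetP => [uvF | [[a b] abF [/f_inj -> /f_inj ->]] //].
by exists (u, v).
Qed.

Lemma copies_hom (F : oriented_graph U) (G : oriented_graph V) H :
  H \in copies F G ->
  exists f : U -> V, [/\ injective f, homomorphism F G f &
                         H.1 = f @: [set: U]].
Proof.
rewrite inE => /andP[/andP[/fintype.subsetP HG _]].
case/existsP=> f /and3P[/injectiveP f_inj /eqP f_im /forallP f_hom].
exists f; split=> // u v uvF; apply: HG.
by have /forallP/(_ v)/eqP <- := f_hom u.
Qed.

Lemma card_copies_vertices (F : oriented_graph U) (G : oriented_graph V) H :
  H \in copies F G -> #|H.1| = #|U|.
Proof. by case/copies_hom=> f [f_inj _ ->]; rewrite card_imset // cardsT. Qed.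

End Homomorphisms.

Section Induced.
Variables W V : finType.

Lemma pullback_oriented (f : W -> V) (G : oriented_graph V) :
  is_oriented [set a : W * W | (f a.1, f a.2) \in arcs G].
Proof.
case: G => A /= /andP[/forallP A_irr /forallP A_anti].
apply/andP; split; apply/forallP => x; first by rewrite inE.
apply/forallP => y; rewrite !inE; apply: (forallP (A_anti (f x))).
Qed.

(** For injective [f], this is the subgraph of [G] induced on the image of [f], relabelled by [W].
    As [ex_o] only ranges over graphs on ordinals, induced subgraphs have to be relabelled. *)
Definition pullback (f : W -> V) (G : oriented_graph V) : oriented_graph W :=
  OrientedGraph (pullback_oriented f G).

Lemma card_arcs_pullback (f : W -> V) (G : oriented_graph V) :
  injective f ->
  #|arcs (pullback f G)| =
  #|[set a in arcs G | [set a.1; a.2] \subset f @: [set: W]]|.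
Proof.
move=> f_inj.
rewrite -(card_imset (f := fun a : W * W => (f a.1, f a.2))); last first.
  by move=> [a b] [c d] [/f_inj -> /f_inj ->].
apply: eq_card => -[x y]; rewrite inE finset.subUset !finset.sub1set /=.
apply/imsetP/and3P => [[[a b] abG [-> ->]] | [xyG /imsetP[a _ xa] /imsetP[b _ yb]]].
  by rewrite inE in abG; rewrite !imset_f.
by exists (a, b); rewrite ?inE /= -?xa -?yb.
Qed.

End Induced.

(** * Arcs and copies inside vertex subsets of fixed size *)

Section Counting.
Variables (U V : finType) (F : oriented_graph U) (G : oriented_graph V).

Definition induced_arcs (M : {set V}) : {set V * V} :=
  [set a in arcs G | [set a.1; a.2] \subset M].

(** Enumerating [M] turns the induced subgraph into a graph on ['I_#|M|] with too many arcs to be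
    [F]-free; a copy found there is pushed forward into [M]. *)
Lemma ex_o_lt_copy (M : {set V}) : (ex_o #|M| F < #|induced_arcs M|)%N ->
  exists2 H, H \in copies F G & H.1 \subset M.
Proof.
have e_im : (@enum_val V M) @: [set: 'I_#|M|] = M.
  apply/finset.setP => x; apply/imsetP/idP => [[i _ ->] | xM].
    exact: enum_valP.
  by exists (enum_rank_in xM x); rewrite ?enum_rankK_in.
have -> : #|induced_arcs M| = #|arcs (pullback (@enum_val V M) G)|.
  by rewrite card_arcs_pullback ?e_im //; apply: enum_val_inj.
move=> lt_ex; set K := pullback _ _ in lt_ex.
have : ~~ copy_free F K.
  apply/negP => freeK; move: lt_ex; rewrite ltnNge => /negP; apply.
  exact: (@leq_bigmax_cond _ (copy_free F) (fun K0 => #|arcs K0|) K).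
case/set0Pn=> H /copies_hom[f [f_inj f_hom _]].
exists (image_subdigraph F (enum_val \o f)).
  apply: image_copies => [|u v uvF]; first exact: inj_comp enum_val_inj f_inj.
  by have := f_hom u v uvF; rewrite inE.
by apply/fintype.subsetP => _ /imsetP[u _ ->]; apply: enum_valP.
Qed.

Lemma sum_induced_arcs (m : nat) : (1 < m)%N ->
  (\sum_(M : {set V} | #|M| == m) #|induced_arcs M| =
   #|arcs G| * 'C(#|V| - 2, m - 2))%N.
Proof.
move=> m_gt1; rewrite -(sum_card_subset (S := fun a => [set a.1; a.2])) //.
(* Absence of loops makes the two ends of an arc distinct. *)
case=> x y; rewrite cards2 /=; have [-> | //] := eqVneq x y.
by case: G => A /= /andP[/forallP/(_ y)/negbTE ->].
Qed.

(** Each set counted on the left contains the vertex set of some copy, and each copy has its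
    vertices in ['C(#|V| - #|U|, m - #|U|)] of the [m]-sets. *)
Lemma card_dense_sets (m : nat) : (#|U| <= m)%N ->
  (#|[set M : {set V} | (#|M| == m) && (ex_o m F < #|induced_arcs M|)]| <=
   #|copies F G| * 'C(#|V| - #|U|, m - #|U|))%N.
Proof.
move=> Um; rewrite -(sum_card_subset (S := fun H => H.1)) //; last first.
  by move=> H; apply: card_copies_vertices.
rewrite -sum1dep_card big_mkcondr /=; apply: leq_sum => M /eqP cM.
case: ifP => //; rewrite -cM => /ex_o_lt_copy[H HG HM].
by rewrite card_gt0; apply/set0Pn; exists H; rewrite inE HG.
Qed.

Lemma card_induced_arcs_le (M : {set V}) :
  (#|induced_arcs M| <= #|M| * #|M|)%N.
Proof.
rewrite -cardsX; apply: subset_leq_card; apply/fintype.subsetP => -[x y].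
by rewrite inE finset.in_setX finset.subUset !finset.sub1set => /andP[].
Qed.

(** A set with at most [ex_o m F] arcs is charged to the first term, any other one also to the
    second. The crude bound [m * m] on its arcs only affects the constant [delta]. *)
Lemma sum_induced_arcs_le (m : nat) :
  (\sum_(M : {set V} | #|M| == m) #|induced_arcs M| <=
   'C(#|V|, m) * ex_o m F +
   #|[set M : {set V} | (#|M| == m) && (ex_o m F < #|induced_arcs M|)]| *
     (m * m))%N.
Proof.
rewrite -card_draws -!sum1dep_card !big_distrl /= [in X in (_ + X)%N]big_mkcondr.
rewrite -big_split /=; apply: leq_sum => M /eqP cM; rewrite !mul1n.
case: ltnP => [_ | le_ex]; last by rewrite addn0.
by rewrite -cM; apply: leq_trans (card_induced_arcs_le M) (leq_addl _ _).
Qed.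

End Counting.

(** * Monotonicity and convergence of the extremal densities *)

Lemma ex_o_averaging (U : finType) (F : oriented_graph U) (m n : nat) :
  (1 < m)%N -> (m <= n)%N ->
  (ex_o n F * 'C(n - 2, m - 2) <= 'C(n, m) * ex_o m F)%N.
Proof.
move=> m_gt1 mn; rewrite {1}/ex_o.
(* Without any [F]-free graph on [n] vertices, [ex_o n F] is an empty maximum, hence 0. *)
have [G Gfree | noG] := pickP (fun G : oriented_graph 'I_n => copy_free F G);
  last by rewrite big_pred0 // mul0n.
rewrite (bigop.bigmax_eq_arg G) //; case: arg_maxnP => // K Kfree _.
have := sum_induced_arcs K m_gt1; rewrite card_ord => <-.
rewrite -[n in 'C(n, m)]card_ord -card_draws -sum1dep_card big_distrl /=.
(* An [m]-set with more than [ex_o m F] arcs would give a copy of [F] in the extremal graph [K]. *)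
apply: leq_sum => M /eqP cM; rewrite mul1n leqNgt; apply/negP.
rewrite -cM => /ex_o_lt_copy[H]; by rewrite (eqP Kfree) inE.
Qed.

Definition ex_o_density (R : realType) (U : finType) (F : oriented_graph U)
    (n : nat) : R :=
  (ex_o n F)%:R / ('C(n, 2))%:R.

Lemma ex_o_density_nonincreasing (R : realType) (U : finType)
    (F : oriented_graph U) (m n : nat) : (1 < m)%N -> (m <= n)%N ->
  ex_o_density R F n <= ex_o_density R F m.
Proof.
move=> m_gt1 mn; have n_gt1 := leq_trans m_gt1 mn.
rewrite /ex_o_density ler_pdivrMr ?ltr0n ?bin_gt0 // mulrAC.
rewrite ler_pdivlMr ?ltr0n ?bin_gt0 // -!natrM ler_nat.
(* After scaling by this binomial, [mul_bin_bin] makes ['C(m, 2)] a common factor, and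
   [ex_o_averaging] remains. *)
have bpos : (0 < 'C(n - 2, m - 2))%N by rewrite bin_gt0 leq_sub2r.
rewrite -(leq_pmul2r bpos) -[leqRHS]mulnA -mul_bin_bin // mulnAC.
by rewrite [leqRHS]mulnCA [leqRHS]mulnA leq_mul2r mulnC [leqRHS]mulnC
  [X in (_ <= X)%N]mulnC mulnC ex_o_averaging ?orbT.
Qed.

Local Open Scope classical_set_scope.

Lemma ex_o_density_cvg (R : realType) (U : finType) (F : oriented_graph U) :
  ex_o_density R F @ \oo --> (pi_o R F : R).
Proof.
suff : cvgn (ex_o_density R F) by [].
(* The densities are bounded below by 0 and nonincreasing from index 2 on, where the denominators
   are nonzero. *)
apply: (@near_nonincreasing_is_cvgn _ _ 0).
  exists 2%N => // m /= m_gt1 n; exact: ex_o_density_nonincreasing.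
by apply: nearW => n; rewrite divr_ge0.
Qed.

Local Close Scope classical_set_scope.

Theorem theorem1p7 (R : realType) (eps : R) (heps : 0 < eps)
  (U : finType) (F : oriented_graph U) (h : nat) (hF : #|U| = h) :
  exists (delta : R) (n0 : nat), 0 < delta /\
    forall (n : nat) (V : finType) (G : oriented_graph V),
      #|V| = n -> (n0 <= n)%N ->
      (pi_o R F + eps) * ('C(n, 2))%:R <= (#|arcs G|)%:R ->
      delta * ('C(n, h))%:R <= (#|copies F G|)%:R.
Proof.
(* Half of [eps] is spent on reaching the limit; the other half survives as the surplus of arcs in
   [B_ge]. *)
have [m [m_gt1 hm ex_m]] : exists m, [/\ (1 < m)%N, (h <= m)%N &
    (ex_o m F)%:R < (pi_o R F + eps / 2) * ('C(m, 2))%:R].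
  have ltP : pi_o R F < pi_o R F + eps / 2 by rewrite ltrDl divr_gt0.
  have [N _ HN] := cvgr_lt _ (@ex_o_density_cvg R U F) _ ltP.
  exists (maxn 2 (maxn h N)); split; rewrite ?leq_max ?leqnn ?orbT //.
  by rewrite -ltr_pdivrMr ?ltr0n ?bin_gt0 ?leq_max //; apply: HN;
    rewrite /= !leq_max leqnn !orbT.
have Cm2 : (0 : R) < ('C(m, 2))%:R by rewrite ltr0n bin_gt0.
have Cmh : (0 : R) < ('C(m, h))%:R by rewrite ltr0n bin_gt0.
have mm : (0 : R) < (m * m)%:R by rewrite ltr0n muln_gt0 (ltnW m_gt1).
(* The factors before the last bound the proportion of dense [m]-sets from below. Dividing by
   ['C(m, h)] passes to copies, since ['C(n, m) / 'C(n - h, m - h) = 'C(n, h) / 'C(m, h)]. *)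
exists (eps / 2 * ('C(m, 2))%:R / (m * m)%:R / ('C(m, h))%:R), m; split.
  by rewrite !divr_gt0 // mulr_gt0 ?divr_gt0.
move=> n V G cV mn arcsG.
have n_gt1 := leq_trans m_gt1 mn.
have := sum_induced_arcs_le F G m.
rewrite sum_induced_arcs // cV; set B := #|finset _| => sum_le.
have := @card_dense_sets _ _ F G m; rewrite hF => /(_ hm); rewrite -/B cV => B_le.
have Cnh : (0 : R) < ('C(n - h, m - h))%:R by rewrite ltr0n bin_gt0 leq_sub2r.
have Cnm : (0 : R) < ('C(n, m))%:R by rewrite ltr0n bin_gt0.
(* The arc total over all [m]-sets is at least [pi_o R F + eps] times ['C(m, 2) * 'C(n, m)], while
   the term with [ex_o m F] is at most [pi_o R F + eps / 2] times it; the dense sets make up the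
   difference. *)
have B_ge : eps / 2 * ('C(m, 2))%:R * ('C(n, m))%:R <= (B * (m * m))%:R :> R.
  have arcs_ge : (pi_o R F + eps) * (('C(m, 2))%:R * ('C(n, m))%:R) <=
      (#|arcs G| * 'C(n - 2, m - 2))%:R :> R.
    rewrite mulrC -natrM mulnC [in leLHS]mul_bin_bin // !natrM mulrC mulrA.
    by apply: ler_wpM2r.
  have := le_trans arcs_ge (_ : _ <= ('C(n, m) * ex_o m F + B * (m * m))%:R).
  rewrite ler_nat natrD (natrM _ 'C(n, m)) => /(_ sum_le).
  have : ('C(n, m))%:R * (ex_o m F)%:R <=
      ('C(n, m))%:R * ((pi_o R F + eps / 2) * ('C(m, 2))%:R) :> R.
    by rewrite ler_pM2l // ltW.
  by move: (B * _)%:R => b; nra.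
rewrite -(ler_pM2r Cnh) -[leRHS]natrM.
apply: le_trans (_ : B%:R <= _); last by rewrite ler_nat.
rewrite -[leLHS]mulrA -natrM -mul_bin_bin // (natrM _ 'C(n, m)).
rewrite (mulrC ('C(n, m))%:R) mulrA divfK ?gt_eqF // mulrAC.
by rewrite ler_pdivrMr // -natrM.
Qed.
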